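(* Let $r$ and $s$ be any non-zero integers that are prime to each other and to $3$. Then the polynomial $p(x,3r/s)=x^3-3x-\frac{3r}{s}$ is irreducible over $\mathbb{Q}$. Hence no such $3r/s$ in $[-2,2]$ belongs to $Tri$.
   Context: Let $S\subseteq\mathbb{R}^2$ contain $(0,0)$ and $(1,0)$. A point is constructible over $S$ if it can be obtained from points of $S$ by a finite sequence of straightedge-and-compass steps: (1) given two distinct points already available, one may draw the line through them, or the circle centered at one of them and passing through the other; (2) given two lines, two circles, or a line and a circle already drawn, one may add their intersection points. $C(S)$ denotes the set of all points constructible over $S$. An angle $\alpha$ (in radians) is trisectable if $(\cos(\alpha/3),\sin(\alpha/3))\in C(\{(0,0),(1,0),(\cos\alpha,\sin\alpha)\})$. A trisection number is a real number of the form $2\cos\alpha$ with $\alpha$ trisectable; $Tri\subseteq[-2,2]$ is the set of all trisection numbers. *)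

(* Defs.v *)
From HB Require Import structures.
From mathcomp Require Import all_boot all_order all_algebra.
From mathcomp Require Import all_classical all_reals all_analysis.

Set Implicit Arguments.
Unset Strict Implicit.
Unset Printing Implicit Defensive.

Import Order.TTheory GRing.Theory Num.Theory.

Local Open Scope classical_set_scope.
Local Open Scope ring_scope.

Section Constructibility.
Variable R : realType.
Implicit Types (A B X : R * R) (S L C : set (R * R)).

Definition line_through A B : set (R * R) :=
  [set X | (X.1 - A.1) * (B.2 - A.2) = (X.2 - A.2) * (B.1 - A.1)].

Definition circle_through A B : set (R * R) :=
  [set X | (X.1 - A.1) ^+ 2 + (X.2 - A.2) ^+ 2 =
           (B.1 - A.1) ^+ 2 + (B.2 - A.2) ^+ 2].

(* Two lines (or two circles) are intersected only when they are distinct as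
   point sets: otherwise every point of a drawn curve would be added. *)
Inductive constructible S : set (R * R) :=
  | constructible_given X : S X -> constructible S X
  | constructible_line_line L1 L2 X :
      drawn_line S L1 -> drawn_line S L2 -> L1 <> L2 ->
      L1 X -> L2 X -> constructible S X
  | constructible_circle_circle C1 C2 X :
      drawn_circle S C1 -> drawn_circle S C2 -> C1 <> C2 ->
      C1 X -> C2 X -> constructible S X
  | constructible_line_circle L C X :
      drawn_line S L -> drawn_circle S C ->
      L X -> C X -> constructible S X
with drawn_line S : set (set (R * R)) :=
  | drawn_line_through A B :
      constructible S A -> constructible S B -> A <> B ->
      drawn_line S (line_through A B)
with drawn_circle S : set (set (R * R)) :=
  | drawn_circle_through A B :
      constructible S A -> constructible S B -> A <> B ->
      drawn_circle S (circle_through A B).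

Definition trisectable (alpha : R) : Prop :=
  constructible [set (0, 0); (1, 0); (cos alpha, sin alpha)]
    (cos (alpha / 3), sin (alpha / 3)).

Definition Tri : set R :=
  [set t | exists alpha : R, trisectable alpha /\ t = 2 * cos alpha].

End Constructibility.

Arguments Tri R : clear implicits.

Definition trisection_poly (F : nzRingType) (y : F) : {poly F} :=
  'X^3 - 3 *: 'X - y%:P.

(* Main.v *)
(** The cubic has a rational root [m / n] in lowest terms only if 3 divides [m],
    hence only if 3 divides [n]; so it has none and is irreducible.
    For the second part, take a maximal subfield [K] of the reals in which the
    cubic [x ^ 3 - 3 x - y] has no root.  If [d ^ 2] is in [K] but [d] is not, and
    [a + b d] is a root, then [b != 0] forces [- 2 a] to be a root in [K]: so
    adjoining [d] creates no root, and [K] is closed under square roots by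
    maximality.  All constructible points then have coordinates in [K], whereas
    [2 cos (alpha / 3)] is a root of the cubic for [y = 2 cos alpha]. *)
Require Import Defs.
From HB Require Import structures.
From mathcomp Require Import all_boot all_order all_algebra.
From mathcomp Require Import all_classical all_reals all_analysis.
From mathcomp Require Import ring lra.

Set Implicit Arguments.
Unset Strict Implicit.
Unset Printing Implicit Defensive.

Import Order.TTheory GRing.Theory Num.Theory.

Local Open Scope classical_set_scope.
Local Open Scope ring_scope.

(** * The cubic and its lack of rational roots *)

Lemma size_trisection_poly (F : nzRingType) (y : F) :
  size (trisection_poly y) = 4%N.
Proof.
rewrite /trisection_poly -addrA size_polyDl ?size_polyXn //.
rewrite (leq_ltn_trans (size_polyD _ _)) // gtn_max !size_polyN.
rewrite (leq_ltn_trans (size_scale_leq _ _)) ?size_polyX //=.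
by rewrite (leq_ltn_trans (size_polyC_leq1 _)).
Qed.

Lemma root_trisection_poly (F : comNzRingType) (y x : F) :
  root (trisection_poly y) x = (x ^+ 3 - 3 * x - y == 0).
Proof. by rewrite /root /trisection_poly !hornerE. Qed.

Lemma trisection_cubic_no_rat_root (r s : int) (x : rat) :
  coprimez r 3 -> coprimez s 3 ->
  x ^+ 3 - 3 * x - 3 * r%:~R / s%:~R != 0.
Proof.
move=> r3 s3; apply/eqP => xP.
have s0 : s != 0 by apply: contraTneq s3 => ->.
set m := numq x; set n := denq x.
have n0 : n != 0 by exact: denq_neq0.
have mn : coprimez m n by rewrite coprimezE; exact: coprime_num_den.
(* Multiplying the equation by [s * n ^ 3] clears all denominators. *)
have int_eq : s * m ^+ 3 - 3 * s * m * n ^+ 2 = 3 * r * n ^+ 3.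
  apply: (@intr_inj rat); rewrite !(rmorphB, rmorphM, rmorphXn) /=.
  have sQ : (s%:~R : rat) != 0 by rewrite intr_eq0.
  have nQ : (n%:~R : rat) != 0 by rewrite intr_eq0.
  move: xP; rewrite -[x]divq_num_den -/m -/n => xP.
  apply/eqP; rewrite -subr_eq0; apply/eqP.
  rewrite -[RHS](mulr0 (s%:~R * n%:~R ^+ 3)) -xP.
  by field; rewrite sQ nQ.
have three_m : (3 %| m)%Z.
  have : (3 %| m ^+ 3 * s)%Z.
    apply/dvdzP; exists (r * n ^+ 3 + s * m * n ^+ 2).
    by move: int_eq; lra.
  by rewrite Gauss_dvdzl 1?coprimez_sym // !dvdzE abszX Euclid_dvdX //; case/andP.
(* With [m = 3 k] one factor 3 cancels, and another still divides [n ^ 3 * r]. *)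
have three_n : (3 %| n)%Z.
  case/dvdzP: three_m => k mk.
  have : (3 %| n ^+ 3 * r)%Z.
    apply/dvdzP; exists (3 * s * k ^+ 3 - s * k * n ^+ 2).
    have three0 : (3 : int) != 0 by [].
    by apply: (mulfI three0); move: int_eq; rewrite mk; lra.
  by rewrite Gauss_dvdzl 1?coprimez_sym // !dvdzE abszX Euclid_dvdX //; case/andP.
have : (3 %| gcdz m n)%Z by rewrite dvdz_gcd three_m three_n.
by rewrite (eqP mn).
Qed.

(** Quotients are matched before products, since a bare inverse has no case. *)
Ltac mem_divring := repeat first [ assumption | match goal with
  | |- is_true ((_ - _) \in _) => apply: rpredB
  | |- is_true ((_ + _) \in _) => apply: rpredD
  | |- is_true ((- _) \in _) => apply: rpredNr
  | |- is_true ((_ / _) \in _) => apply: rpred_div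
  | |- is_true ((_ * _) \in _) => apply: rpredM
  | |- is_true ((_ ^+ _) \in _) => apply: rpredX
  | |- is_true (_%:R \in _) => apply: rpred_nat
  | |- is_true (1 \in _) => apply: rpred1
  | |- is_true (0 \in _) => apply: rpred0
  end ].

(** * Quadratic extensions of a subfield *)

Section QuadraticExtension.
Variables (F : fieldType) (K : divringClosed F) (d : F).
Hypotheses (Kd2 : d ^+ 2 \in K) (Kd : d \notin K).

(** The field [K(d)], given as a set so that inclusion can compare it with a maximal set of
    reals. *)
Definition quadratic_ext : set F :=
  [set z | exists a b : F, [/\ a \in K, b \in K & z = a + b * d]].

(** Linear independence of [1] and [d] over [K]: a relation with [b != 0] would put [d = - a / b] in
    [K]. *)
Lemma quadratic_coord_eq0 a b :
  a \in K -> b \in K -> a + b * d = 0 -> a = 0 /\ b = 0.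
Proof.
move=> Ka Kb ab0; have [b0|b0] := eqVneq b 0.
  by split=> //; move: ab0; rewrite b0 mul0r addr0.
case/negP: Kd; have -> : d = - a / b.
  apply: (mulIf b0); rewrite mulfVK //.
  by apply/eqP; rewrite mulrC -addr_eq0 addrC ab0.
by mem_divring.
Qed.

Lemma quadratic_ext_base a : a \in K -> quadratic_ext a.
Proof. by move=> Ka; exists a, 0; rewrite rpred0 mul0r addr0. Qed.

Lemma quadratic_ext_gen : quadratic_ext d.
Proof. by exists 0, 1; rewrite rpred0 rpred1 mul1r add0r. Qed.

Lemma quadratic_extB x y :
  quadratic_ext x -> quadratic_ext y -> quadratic_ext (x - y).
Proof.
move=> [a [b [Ka Kb ->]]] [e [f [Ke Kf ->]]].
by exists (a - e), (b - f); rewrite !rpredB //; split => //; ring.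
Qed.

Lemma quadratic_ext_div x y :
  quadratic_ext x -> quadratic_ext y -> quadratic_ext (x / y).
Proof.
move=> [a [b [Ka Kb ->]]] [e [f [Ke Kf ->]]].
have [ef0|ef0] := eqVneq (e + f * d) 0.
  by rewrite ef0 invr0 mulr0; apply: quadratic_ext_base; rewrite rpred0.
(* The conjugate of the denominator must be nonzero too, as the quotient is expanded by it; [N] is
   the norm. *)
have ef0' : e - f * d != 0.
  apply/eqP; rewrite -mulNr => ef1.
  have [e0 f0] := quadratic_coord_eq0 Ke (rpredNr Kf) ef1.
  move: ef0; rewrite e0; move/eqP: f0; rewrite oppr_eq0 => /eqP ->.
  by rewrite mul0r addr0 eqxx.
pose N := e ^+ 2 - f ^+ 2 * d ^+ 2.
have NE : N = (e + f * d) * (e - f * d) by rewrite /N; ring.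
have KN : N \in K by rewrite /N; mem_divring.
exists ((a * e - b * f * d ^+ 2) / N), ((b * e - a * f) / N).
split.
- by mem_divring.
- by mem_divring.
- by rewrite NE; field; rewrite ef0 ef0'.
Qed.

(* The third root of the cubic is [- (x + x')], where [x'] is the conjugate
   of the root [x = a + b * d], i.e. [- 2 * a]. *)
Lemma quadratic_ext_trisection_root t x :
  t \in K -> quadratic_ext x -> x ^+ 3 - 3 * x - t = 0 ->
  exists2 z, z \in K & z ^+ 3 - 3 * z - t = 0.
Proof.
move=> Kt [a [b [Ka Kb ->]]] xP.
(* These are the coordinates, with respect to [1] and [d], of the cubic at [a + b * d]. *)
have [|||u0 v0] := @quadratic_coord_eq0
    (a ^+ 3 + 3 * a * (b ^+ 2 * d ^+ 2) - 3 * a - t)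
    ((3 * a ^+ 2 + b ^+ 2 * d ^+ 2 - 3) * b).
- by mem_divring.
- by mem_divring.
- by rewrite -[RHS]xP; ring.
have [b0|b0] := eqVneq b 0.
  by exists a => //; rewrite -[RHS]xP b0; ring.
exists (- (2 * a)); first by mem_divring.
move/eqP: v0; rewrite mulf_eq0 (negbTE b0) orbF => /eqP v0.
transitivity ((a ^+ 3 + 3 * a * (b ^+ 2 * d ^+ 2) - 3 * a - t)
  - 3 * a * (3 * a ^+ 2 + b ^+ 2 * d ^+ 2 - 3)); first by ring.
by rewrite u0 v0; ring.
Qed.

End QuadraticExtension.

(* Constructible points over a subfield closed under square roots *)
Scheme constructible_ind_mut := Minimality for constructible Sort Prop
  with drawn_line_ind_mut := Minimality for drawn_line Sort Prop
  with drawn_circle_ind_mut := Minimality for drawn_circle Sort Prop.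

Section ConstructibleCoordinates.
Variables (R : realType) (K : divringClosed R).
Hypothesis K_sqrt : forall z, z ^+ 2 \in K -> z \in K.

(** Here and below, rational means rational over [K]. *)
Definition rational_point (X : R * R) := X.1 \in K /\ X.2 \in K.

(** Cramer's rule writes the solution with field operations only. *)
Lemma line_line_rational a1 b1 c1 a2 b2 c2 (x y : R) :
  a1 \in K -> b1 \in K -> c1 \in K -> a2 \in K -> b2 \in K -> c2 \in K ->
  a1 * b2 - a2 * b1 != 0 ->
  a1 * x + b1 * y = c1 -> a2 * x + b2 * y = c2 -> x \in K /\ y \in K.
Proof.
move=> Ka1 Kb1 Kc1 Ka2 Kb2 Kc2 D0 e1 e2.
have -> : x = (c1 * b2 - c2 * b1) / (a1 * b2 - a2 * b1).
  by rewrite -e1 -e2; field.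
have -> : y = (a1 * c2 - a2 * c1) / (a1 * b2 - a2 * b1).
  by rewrite -e1 -e2; field.
by split; mem_divring.
Qed.

(* After translating the center to the origin, [b u - a v] has the rational
   square [(a ^ 2 + b ^ 2) rho - (a u + b v) ^ 2]. *)
Lemma line_circle_rational a b c p q rho (x y : R) :
  a \in K -> b \in K -> c \in K -> p \in K -> q \in K -> rho \in K ->
  (a != 0) || (b != 0) ->
  a * x + b * y = c -> (x - p) ^+ 2 + (y - q) ^+ 2 = rho ->
  x \in K /\ y \in K.
Proof.
move=> Ka Kb Kc Kp Kq Krho ab0 line circ.
pose n := a ^+ 2 + b ^+ 2.
have n0 : n != 0 by rewrite /n paddr_eq0 ?sqr_ge0 // !sqrf_eq0 negb_and.
pose c' := c - a * p - b * q.
pose w := b * (x - p) - a * (y - q).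
have Kn : n \in K by rewrite /n; mem_divring.
have Kc' : c' \in K by rewrite /c'; mem_divring.
have Kw : w \in K.
  apply: K_sqrt; have -> : w ^+ 2 = n * rho - c' ^+ 2.
    by rewrite /w /n /c' -line -circ; ring.
  by mem_divring.
(* The offset from the center is recovered from its inner product [c'] and its cross product [w]
   with [(a, b)]. *)
have -> : x = p + (a * c' + b * w) / n.
  by move: n0; rewrite /c' /w /n -line => n0; field.
have -> : y = q + (b * c' - a * w) / n.
  by move: n0; rewrite /c' /w /n -line => n0; field.
by split; mem_divring.
Qed.

Lemma neq_coord (A B : R * R) :
  A <> B -> (B.1 - A.1 != 0) || (B.2 - A.2 != 0).
Proof.
move=> AB; rewrite -negb_and; apply/andP => -[].
rewrite !subr_eq0 => /eqP e1 /eqP e2; apply: AB.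
by move: A B e1 e2 => [? ?] [? ?] /= -> ->.
Qed.

(* [u a = v b] says that [(u, v)] has direction [(b, a)]. *)
Lemma parallel_transfer (a b c e u v : R) :
  (b != 0) || (a != 0) -> a * e = c * b -> u * a = v * b -> u * c = v * e.
Proof.
move=> ab0 det uv; case/orP: ab0 => n0; apply: (mulfI n0).
  by transitivity (u * (c * b)); [ring | rewrite -det mulrA uv; ring].
by transitivity (c * (u * a)); [ring | rewrite uv mulrCA -det; ring].
Qed.

(** Distinctness excludes [line_through A A], which is the whole plane. *)
Definition rational_line (L : set (R * R)) := exists A B,
  [/\ rational_point A, rational_point B, A <> B & L = line_through A B].

Definition rational_circle (C : set (R * R)) := exists A B,
  [/\ rational_point A, rational_point B & C = circle_through A B].

Lemma rational_line_line L1 L2 X :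
  rational_line L1 -> rational_line L2 -> L1 <> L2 ->
  L1 X -> L2 X -> rational_point X.
Proof.
move=> [A [B [[KA1 KA2] [KB1 KB2] AB ->]]].
move=> [C [D [[KC1 KC2] [KD1 KD2] CD ->]]] L12 e1 e2.
rewrite /line_through /= in e1 e2.
set a := B.2 - A.2 in e1; set b := B.1 - A.1 in e1.
set c := D.2 - C.2 in e2; set e := D.1 - C.1 in e2.
have [Ka Kb] : a \in K /\ b \in K by rewrite /a /b; split; mem_divring.
have [Kc Ke] : c \in K /\ e \in K by rewrite /c /e; split; mem_divring.
(* A nonzero determinant allows Cramer's rule; otherwise the lines are parallel. *)
have [D0|D0] := eqVneq (a * - e - c * - b) 0; last first.
  apply: (@line_line_rational a (- b) (a * A.1 - b * A.2)
    c (- e) (c * C.1 - e * C.2)) => //; try by mem_divring.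
    by move: e1; lra.
  by move: e2; lra.
have D0' : a * e = c * b by move: D0; lra.
(* The base point of a line can be moved to the common point [X], so parallel lines through [X]
   coincide. *)
have onL (U V Y : R * R) : line_through U V X ->
    (line_through U V Y <->
     (Y.1 - X.1) * (V.2 - U.2) = (Y.2 - X.2) * (V.1 - U.1)).
  by rewrite /line_through /= => XP; split => YP; move: XP YP; lra.
case: L12; apply/seteqP; split => Y.
- move=> /(onL A B Y e1) YP; apply/(onL C D Y e2).
  exact: (parallel_transfer (neq_coord AB) D0').
- move=> /(onL C D Y e2) YP; apply/(onL A B Y e1).
  by apply: (parallel_transfer (neq_coord CD)) YP; rewrite -/a -/b -/c -/e; lra.
Qed.

Lemma rational_line_circle L C X :
  rational_line L -> rational_circle C -> L X -> C X -> rational_point X.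
Proof.
move=> [A [B [[KA1 KA2] [KB1 KB2] /neq_coord AB ->]]].
move=> [P [Q [[KP1 KP2] [KQ1 KQ2] ->]]]; rewrite /line_through /= => line circ.
have line' : (B.2 - A.2) * X.1 + (A.1 - B.1) * X.2 =
    (B.2 - A.2) * A.1 + (A.1 - B.1) * A.2 by move: line; lra.
apply: (line_circle_rational _ _ _ KP1 KP2 _ _ line' circ).
- by mem_divring.
- by mem_divring.
- by mem_divring.
- by mem_divring.
- by rewrite orbC -(opprB B.1) oppr_eq0.
Qed.

(* Subtracting the equations of two circles yields their radical axis, which
   is degenerate only for concentric circles. *)
Lemma rational_circle_circle C1 C2 X :
  rational_circle C1 -> rational_circle C2 -> C1 <> C2 ->
  C1 X -> C2 X -> rational_point X.
Proof.
move=> [P [Q [[KP1 KP2] [KQ1 KQ2] ->]]].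
move=> [P' [Q' [[KP1' KP2'] [KQ1' KQ2'] ->]]] C12.
rewrite /circle_through /= => circ circ'.
(* Concentric circles sharing [X] have the same radius, hence coincide. *)
have PP' : P' <> P.
  by move=> PP'; apply: C12; rewrite /circle_through -circ -circ' PP'.
have axis : 2 * (P'.1 - P.1) * X.1 + 2 * (P'.2 - P.2) * X.2 =
    (Q.1 - P.1) ^+ 2 + (Q.2 - P.2) ^+ 2
    - ((Q'.1 - P'.1) ^+ 2 + (Q'.2 - P'.2) ^+ 2)
    + (P'.1 ^+ 2 - P.1 ^+ 2 + (P'.2 ^+ 2 - P.2 ^+ 2)).
  by rewrite -circ -circ'; ring.
apply: (line_circle_rational _ _ _ KP1 KP2 _ _ axis circ).
- by mem_divring.
- by mem_divring.
- by mem_divring.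
- by mem_divring.
- by rewrite !mulf_eq0 !pnatr_eq0 /=; exact: neq_coord (nesym PP').
Qed.

Lemma constructible_rational (S : set (R * R)) :
  S `<=` rational_point -> constructible S `<=` rational_point.
Proof.
(* Mutual induction: drawn lines and circles keep defining points over [K]. *)
move=> KS; apply: (constructible_ind_mut (P := rational_point)
    (P0 := rational_line) (P1 := rational_circle)) => //.
- by move=> L1 L2 X _ HL1 _ HL2; exact: rational_line_line.
- by move=> C1 C2 X _ HC1 _ HC2; exact: rational_circle_circle.
- by move=> L C X _ HL _ HC; exact: rational_line_circle.
- by move=> A B _ KA _ KB AB; exists A, B.
- by move=> A B _ KA _ KB AB; exists A, B.
Qed.

End ConstructibleCoordinates.

(** * A maximal subfield without roots of the cubic *)

Section MaximalSubfield.
Variables (R : realType) (t : rat).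
Hypothesis no_rat_root : forall q : rat, q ^+ 3 - 3 * q - t != 0.

Local Notation y := (ratr t : R).

(* [1 \in A] is not required, so that the empty chain causes no trouble. *)
Definition rootless_field (A : set R) : Prop :=
  [/\ forall u v, A u -> A v -> A (u - v),
      forall u v, A u -> A v -> A (u / v) &
      forall z, A z -> z ^+ 3 - 3 * z - y != 0].

Lemma rootless_field_rat : rootless_field (range (@ratr R)).
Proof.
split.
- by move=> _ _ [u _ <-] [v _ <-]; exists (u - v); rewrite ?rmorphB.
- by move=> _ _ [u _ <-] [v _ <-]; exists (u / v); rewrite ?fmorph_div.
- move=> _ [q _ <-]; have <- : ratr (q ^+ 3 - 3 * q - t) =
      ratr q ^+ 3 - 3 * ratr q - y :> R.
    by rewrite !(rmorphB, rmorphM, rmorphXn) /= ratr_nat.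
  by rewrite fmorph_eq0.
Qed.

Lemma rootless_field_maximal :
  exists A, rootless_field A /\ forall B, A `<` B -> ~ rootless_field B.
Proof.
apply: Zorn_bigcup => F FP Ftot.
(* Any two elements of the union of a chain lie in a single member, which yields closure. *)
have common u v : (\bigcup_(X in F) X) u -> (\bigcup_(X in F) X) v ->
    exists2 X, F X & X u /\ X v.
  move=> [X FX Xu] [Y FY Yv]; have [XY|YX] := Ftot _ _ FX FY.
    by exists Y => //; split=> //; exact: XY.
  by exists X => //; split=> //; exact: YX.
split.
- move=> u v Fu Fv; have [X FX [Xu Xv]] := common _ _ Fu Fv.
  by exists X => //; have [XB _ _] := FP _ FX; exact: XB.
- move=> u v Fu Fv; have [X FX [Xu Xv]] := common _ _ Fu Fv.
  by exists X => //; have [_ XD _] := FP _ FX; exact: XD.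
- by move=> z [X FX Xz]; have [_ _ Xroot] := FP _ FX; exact: Xroot.
Qed.

Lemma sqrt_closed_rootless_field :
  exists K : divringClosed R, (forall z, z ^+ 2 \in K -> z \in K) /\
    (forall z, z \in K -> z ^+ 3 - 3 * z - y != 0).
Proof.
have [A [[AB AD Aroot] Amax]] := rootless_field_maximal.
(* Without a nonzero element, [A] would lie strictly below the rationals, against maximality. *)
have A1 : A 1.
  have [[a Aa a0]|A0] := pselect (exists2 a, A a & a != 0).
    by rewrite -(divff a0); exact: AD.
  have A0' a : A a -> a = 0.
    by move=> Aa; apply: contrapT => /eqP a0; apply: A0; exists a.
  exfalso; apply: (Amax (range (@ratr R))); last exact: rootless_field_rat.
  split; first by move=> a /A0' ->; exists 0; rewrite ?rmorph0.
  move=> QA; have /A0' : A 1 by apply: QA; exists 1; rewrite ?rmorph1.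
  by move/eqP; rewrite oner_eq0.
pose S : {pred R} := mem A.
have S_closed : GRing.divring_closed S.
  by split; rewrite /S ?inE // => u v; rewrite !inE; [exact: AB|exact: AD].
pose K : divringClosed R :=
  HB.pack S (GRing.isDivringClosed.Build R S S_closed).
have KE z : (z \in K) = (z \in A) by [].
exists K; split; last by move=> z; rewrite KE inE; exact: Aroot.
move=> d Kd2; apply: contrapT => /negP Kd.
have Ky : y \in K by rewrite rpred_rat.
(* If [d] were missing, [K(d)] would be a strictly larger rootless field. *)
apply: (Amax (quadratic_ext K d)).
  split; first by move=> a Aa; apply: quadratic_ext_base; rewrite KE inE.
  by move=> /(_ d (quadratic_ext_gen K d)) Ad; case/negP: Kd; rewrite KE inE.
split.
- by move=> u v; exact: quadratic_extB.
- by move=> u v; exact: quadratic_ext_div.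
- move=> x Ex; apply/eqP => x0.
  have [z Kz /eqP] := quadratic_ext_trisection_root Kd2 Kd Ky Ex x0.
  by apply/negP; apply: Aroot; rewrite KE inE in Kz.
Qed.

End MaximalSubfield.

(** * The triple-angle formula and the conclusion *)

Lemma cos_triple (R : realType) (a : R) :
  cos (3 * a) = 4 * cos a ^+ 3 - 3 * cos a.
Proof.
have -> : 3 * a = a + a + a by ring.
transitivity (cos a ^+ 3 - 3 * sin a ^+ 2 * cos a).
  by rewrite !cosD sinD; ring.
by rewrite sin2cos2; ring.
Qed.

Lemma rat_not_Tri (R : realType) (t : rat) :
  (forall q : rat, q ^+ 3 - 3 * q - t != 0) -> ~ Tri R (ratr t).
Proof.
move=> no_root [alpha [tri tE]].
have [K [K_sqrt K_root]] := sqrt_closed_rootless_field R no_root.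
have Kcos : cos alpha \in K.
  have -> : cos alpha = ratr t / 2 by rewrite tE; field.
  by rewrite rpred_div ?rpred_nat ?rpred_rat.
have Ksin : sin alpha \in K.
  by apply: K_sqrt; rewrite sin2cos2 rpredB ?rpred1 ?rpredX.
have [|Kthird _] := constructible_rational K_sqrt _ tri.
  by move=> X [[->|->]|->]; split => //=; rewrite ?rpred0 ?rpred1.
(* For [x = 2 cos u], the triple-angle formula reads [x ^ 3 - 3 x = 2 cos (3 u)], so this element of
   [K] is a forbidden root. *)
have /K_root/eqP : 2 * cos (alpha / 3) \in K by rewrite rpredM ?rpred_nat.
apply; rewrite tE; have -> : cos alpha = cos (3 * (alpha / 3)).
  by congr cos; field.
by rewrite cos_triple; ring.
Qed.

Theorem proposition3p3 (R : realType) (r s : int)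
    (hr : r != 0) (hs : s != 0)
    (hrs : coprimez r s) (hr3 : coprimez r 3) (hs3 : coprimez s 3) :
  irreducible_poly (trisection_poly (3 * r%:~R / s%:~R : rat)) /\
  (- 2 <= 3 * r%:~R / s%:~R :> R -> 3 * r%:~R / s%:~R <= 2 :> R ->
   ~ Tri R (3 * r%:~R / s%:~R)).
Proof.
have no_root x := trisection_cubic_no_rat_root x hr3 hs3.
split.
  apply: cubic_irreducible; rewrite ?size_trisection_poly // => x.
  by rewrite root_trisection_poly.
move=> _ _; have := rat_not_Tri (R := R) no_root.
by rewrite fmorph_div rmorphM /= !ratr_int ratr_nat.
Qed.
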